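(* Let $N,n\ge 1$ and let $f_1,\dots,f_N:\mathbb{R}^n\to\mathbb{R}$ and the communication graph $\mathcal{G}$ satisfy: (1) $\mathcal{G}$ is directed and strongly connected; (2) each $f_i$ is convex with bounded subgradient; (3) each $f_i$ is smooth with constant $l_i$ (i.e. $\nabla f_i$ is $l_i$-Lipschitz) and strongly convex with constant $\sigma_i$; (4) $\dfrac{\left(\sum_{i=1}^N l_i\right)^2}{N\sum_{i=1}^N l_i^2}>\dfrac34$. Let $\mathbf{x}^*$ be the minimizer over $\mathbb{R}^n$ of $F(\mathbf{x})=\frac1N\sum_{i=1}^N f_i(\mathbf{x})$. Then there is a choice of step sizes $\{\alpha_k\}_{k\ge 0}$ (common to all agents at each time) such that the sequences $\{\mathbf{x}_i(k)\}_{k\ge0}$, $1\le i\le N$, generated by the delay-robust algorithm described in the context satisfy the following: for every $\varepsilon>0$ and every $i\in\{1,\dots,N\}$ there is $k_3$ such that for each $k\ge k_3$, $$\|\mathbf{x}_i(k)-\mathbf{x}^*\|<O(\varepsilon),$$ where the constant implicit in $O(\varepsilon)$ does not depend on $k$ or $\varepsilon$.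
   Context: Network. $\mathcal{G}=(\mathcal{V},\mathcal{E})$ is a directed graph with nodes $v_1,\dots,v_N$ and weighted adjacency matrix $\mathbf{A}=(a_{ij})$, where $a_{ij}>0$ if $(v_j,v_i)\in\mathcal{E}$ and $a_{ij}=0$ otherwise; $\mathbf{A}$ is row-stochastic. The row vector $\mathbf{u}=(\mathbf{u}_1,\dots,\mathbf{u}_N)$ is the left eigenvector of $\mathbf{A}$ for eigenvalue $1$, normalized by $\sum_i\mathbf{u}_i=1$, and $\bar{\mathbf{u}}=\mathbf{u}\otimes\mathbf{I}_n$ (an $n\times Nn$ matrix). $\|\cdot\|$ is the Euclidean norm. Algorithm. Time index $k$ denotes the instant $kT_g/2$, where $T_g$ is the period of a square wave $g_i(t)=\frac12\left(\mathrm{sgn}(\sin(2\pi t/T_g))+1\right)$ synchronized over all nodes. Information from in-neighbours arrives with a time-varying bounded delay $\tau(t)$ with mean $\bar\tau$; $T_g$ is chosen so that quantities received at instant $kT_g/2$ are those of instant $(k-1)T_g/2$. Initial states $\mathbf{x}_i(0)\in\mathbb{R}^n$ are arbitrary. (a) Eigenvector estimates: $\mathbf{e}_i(0)$ is the $i$-th standard basis vector of $\mathbb{R}^N$ and $\mathbf{e}_i(k)=\sum_{j=1}^N a_{ij}\mathbf{e}_j(k-1)$. The entries $[\mathbf{e}_i(k)]_i$ are positive for all $i,k$, so that the divisions below make sense. Write $G(k)\in\mathbb{R}^{Nn}$ for the stacked vector with blocks $\dfrac{\nabla f_i(\mathbf{x}_i(k))}{[\mathbf{e}_i(k)]_i}$,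 $1\le i\le N$. (b) Dynamic average tracking between update instants, with discrete derivative $\dot{y}(t)=y(t+1)-y(t)$ and gain $\kappa'=\kappa/d_{ii}$, $d_{ii}=\sum_j a_{ij}$: $\mathbf{r}_i$ evolves by $\dot{\mathbf{r}}_i(t)=(\text{change of block } i \text{ of } G, \text{ injected at the instants } lT_g/2)-\kappa'\sum_j a_{ij}(\mathbf{r}_i(t)-\mathbf{r}_j(t-\tau(t)))$ and $s_i$ evolves by $\dot{s}_i(t)=\dot{g}_i(t)-\kappa'\sum_j a_{ij}(s_i(t)-s_j(t-\tau(t)))$. In the $l$-th epoch of length $T_g/2$ let $\mathbf{c}_r(l)$ be the equilibrium value of $\mathbf{r}_i$ due to the perturbation $G(l)-G(l-1)$, and $c_s,c_s'$ the new and previous equilibrium values of $s_i$. By the known tracking result, the perturbation contributes $\bar{\mathbf{u}}(G(l)-G(l-1))/(1+\kappa\bar\tau)$ to the equilibrium of $\mathbf{r}_i$, and $|c_s-c_s'|=1/(1+\kappa\bar\tau)$, so $\dfrac{\mathbf{c}_r(l)}{|c_s-c_s'|}=\bar{\mathbf{u}}\,(G(l)-G(l-1))$. (c) Direction: $\mathbf{p}_i(k+1)=\sum_{l=1}^{k}\dfrac{\mathbf{c}_r(l)}{|c_s-c_s'|}+\bar{\mathbf{u}}\,G(0)$. (d) Descent: $\mathbf{x}_i(k+1)=\sum_{j=1}^N a_{ij}\mathbf{x}_j(k)-\alpha_k\,\mathbf{p}_i(k+1)$, where $\alpha_k$ is the step size, common to all agents. *)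

(* Defs.v *)
From HB Require Import structures.
From mathcomp Require Import all_boot all_order all_algebra.
From mathcomp Require Import all_classical all_reals all_analysis.
Set Implicit Arguments.
Unset Strict Implicit.
Unset Printing Implicit Defensive.
Import Order.TTheory GRing.Theory Num.Theory.
Import numFieldNormedType.Exports.
Local Open Scope classical_set_scope.
Local Open Scope ring_scope.

Section Functions.
Context {R : realType} {n : nat}.
Implicit Types (f : 'rV[R]_n -> R) (x y g : 'rV[R]_n).

Definition dot x y : R := \sum_j x 0 j * y 0 j.

(* The library norm on 'rV[R]_n is the sup norm. *)
Definition enorm x : R := Num.sqrt (dot x x).

Definition grad f x : 'rV[R]_n := \row_j 'D_(delta_mx 0 j) (f : _ -> R^o) x.

Definition convex f : Prop :=
  convex_function [set: convex_lmodType 'rV[R]_n] f.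

Definition strongly_convex f (sigma : R) : Prop :=
  0 < sigma /\ convex (fun x => f x - sigma / 2 * enorm x ^+ 2).

Definition smooth f (l : R) : Prop :=
  (forall x, differentiable (f : _ -> R^o) x) /\
  (forall x y, enorm (grad f x - grad f y) <= l * enorm (x - y)).

Definition subgradient f x g : Prop :=
  forall y, f x + dot g (y - x) <= f y.

(* The bound is uniform over each ball, not over the whole space: the gradient
   of a strongly convex function is unbounded on R^n for n >= 1. A global bound
   is a special case. *)
Definition bounded_subgradient f : Prop :=
  forall r : R, exists L : R,
    forall x g, enorm x <= r -> subgradient f x g -> enorm g <= L.

End Functions.

Section Network.
Context {R : realType} {N : nat}.

(* [E j i] stands for the edge (v_j, v_i), along which v_i hears v_j. *)
Definition weighted_adjacency (E : rel 'I_N) (A : 'M[R]_N) : Prop :=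
  forall i j, (E j i -> 0 < A i j) /\ (~~ E j i -> A i j = 0).

Definition row_stochastic (A : 'M[R]_N) : Prop :=
  forall i, \sum_j A i j = 1.

Definition strongly_connected (E : rel 'I_N) : Prop :=
  forall i j, connect E i j.

Definition normalized_left_eigenvector (A : 'M[R]_N) (u : 'rV[R]_N) : Prop :=
  u *m A = u /\ \sum_i u 0 i = 1.

Fixpoint eig_est (A : 'M[R]_N) (k : nat) : 'I_N -> 'rV[R]_N :=
  match k with
  | 0 => fun i => delta_mx 0 i
  | k'.+1 => fun i => \sum_j A i j *: eig_est A k' j
  end.

(* A stacked vector of R^(Nm) with blocks w_1, ..., w_N is encoded as the N x m
   matrix W with rows w_i; (u (x) I_m) applied to it is sum_i u_i w_i, that is,
   u *m W. *)
Definition ubar (u : 'rV[R]_N) {m : nat} (W : 'M[R]_(N, m)) : 'rV[R]_m :=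
  u *m W.

End Network.

Section Tracking.
Context {R : realType} {N : nat}.
Variables (A : 'M[R]_N) (kappa : R) (tau : nat -> nat) (T : nat).

(* Dynamic average tracking on the fine time scale, where one half-period T_g/2
   of the square wave lasts T ticks. The dynamics being linear, the effect of
   the perturbation W injected at the instant l T_g/2 (row i at node i) is the
   trajectory, started at rest, that has W as its only input. The truncation in
   [t - tau t] is harmless, since [y 0 = 0]. *)
Definition response (m : nat) (l : nat) (W : 'M[R]_(N, m))
    (y : nat -> 'M[R]_(N, m)) : Prop :=
  y 0%N = 0 /\
  forall t i,
    row i (y t.+1) - row i (y t) =
      (if t == (l * T)%N then row i W else 0)
      - (kappa / \sum_j A i j) *:
          \sum_j A i j *: (row i (y t) - row j (y (t - tau t)%N)).

Definition equilibrium_due_to (m : nat) (l : nat) (W : 'M[R]_(N, m))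
    (c : 'rV[R]_m) : Prop :=
  exists2 y, response l W y & forall i j, y t i j @[t --> \oo] --> c 0 j.

(* The known steady-state property of the tracker, assumed of the gain and of
   the delays: it holds for instance for constant delays and small gains. *)
Definition tracking_result (u : 'rV[R]_N) (taubar : R) : Prop :=
  forall (m l : nat) (W : 'M[R]_(N, m)), (0 < l)%N ->
    equilibrium_due_to l W ((1 + kappa * taubar)^-1 *: ubar u W).

Definition square_wave (Tg t : R) : R :=
  2^-1 * (Num.sg (sin (2 * pi * t / Tg)) + 1).

(* Change of the square wave at the instant l T_g/2. The wave is constant inside
   each epoch and equals 1/2 at the switching instants, so that its values are
   read at the midpoints of the two adjacent epochs. *)
Definition wave_jump (l : nat) : R :=
  square_wave (2 * T%:R) ((l%:R + 2^-1) * T%:R) -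
  square_wave (2 * T%:R) ((l%:R - 2^-1) * T%:R).

End Tracking.

Section Algorithm.
Context {R : realType} {N n : nat}.
Variables (f : 'I_N -> 'rV[R]_n -> R) (A : 'M[R]_N) (u : 'rV[R]_N).

Definition scaled_grads (x : nat -> 'I_N -> 'rV[R]_n) (k : nat) : 'M[R]_(N, n) :=
  \matrix_i ((eig_est A k i 0 i)^-1 *: grad (f i) (x k i)).

(* [x k i], [p k i] are the state and direction of node i at the instant k T_g/2;
   [cs l] is the equilibrium of s_i in epoch l, so that c_s and c_s' are
   [cs l] and [cs l.-1]. The initial states [x 0] are unconstrained, and
   [p 0], [cr 0] are not used. *)
Record delay_robust_run (kappa : R) (tau : nat -> nat) (T : nat)
    (alpha : nat -> R) (x p : nat -> 'I_N -> 'rV[R]_n)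
    (cr : nat -> 'rV[R]_n) (cs : nat -> R) : Prop := {
  run_cr : forall l, (0 < l)%N ->
    equilibrium_due_to A kappa tau T l
      (scaled_grads x l - scaled_grads x l.-1) (cr l) ;
  run_cs : forall l, (0 < l)%N ->
    equilibrium_due_to A kappa tau T l
      (const_mx (wave_jump T l) : 'M[R]_(N, 1)) (cs l - cs l.-1)%:M ;
  run_direction : forall k i,
    p k.+1 i = \sum_(1 <= l < k.+1) `|cs l - cs l.-1|^-1 *: cr l
               + ubar u (scaled_grads x 0%N) ;
  run_descent : forall k i,
    x k.+1 i = \sum_j A i j *: x k j - alpha k *: p k.+1 i
}.

Definition average_cost (x : 'rV[R]_n) : R := N%:R^-1 * \sum_i f i x.

End Algorithm.

(* Main.v *)
(* Responses of the tracker are unique, so its equilibria are those of the known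
   tracking result and the direction telescopes to
   p(k+1) = sum_j (u_j / [e_j(k)]_j) grad f_j(x_j(k)), the same vector at every
   node.  Hence differences x_i - x_j evolve by A alone and vanish, A being
   primitive: it is irreducible, and a_ii = [e_i(1)]_i > 0.  The same argument
   applied to the e_i gives [e_j(k)]_j -> u_j.  Each x_i thus follows gradient
   descent on sum_j f_j up to an error eta_k (1 + |x_i - x*|) with eta_k -> 0,
   and for a small constant step the exact descent map is a contraction. *)
Require Import Defs.
From mathcomp Require Import all_boot all_order all_algebra.
From mathcomp Require Import all_classical all_reals all_analysis.
From mathcomp Require Import ring lra.
Import Order.TTheory GRing.Theory Num.Theory.
Import numFieldNormedType.Exports.
Local Open Scope classical_set_scope.
Local Open Scope ring_scope.

(** * Euclidean inner product and norm *)

Section Euclidean.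
Context {R : realType} {n : nat}.
Implicit Types (x y z : 'rV[R]_n) (a : R).

Lemma dotC x y : dot x y = dot y x.
Proof. by apply: eq_bigr => j _; rewrite mulrC. Qed.

Lemma dotDl x y z : dot (x + y) z = dot x z + dot y z.
Proof. by rewrite -big_split; apply: eq_bigr => j _; rewrite mxE mulrDl. Qed.

Lemma dotDr x y z : dot x (y + z) = dot x y + dot x z.
Proof. by rewrite dotC dotDl !(dotC x). Qed.

Lemma dotZl a x y : dot (a *: x) y = a * dot x y.
Proof. by rewrite mulr_sumr; apply: eq_bigr => j _; rewrite mxE mulrA. Qed.

Lemma dotZr a x y : dot x (a *: y) = a * dot x y.
Proof. by rewrite dotC dotZl dotC. Qed.

Lemma dotNl x y : dot (- x) y = - dot x y.
Proof. by rewrite -scaleN1r dotZl mulN1r. Qed.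

Lemma dotNr x y : dot x (- y) = - dot x y.
Proof. by rewrite dotC dotNl dotC. Qed.

Lemma dot0l y : dot 0 y = 0.
Proof. by rewrite -(scale0r 0) dotZl mul0r. Qed.

Lemma dot_suml (I : finType) (F : I -> 'rV[R]_n) y :
  dot (\sum_i F i) y = \sum_i dot (F i) y.
Proof. exact: (big_morph (dot^~ y) (fun u v => dotDl u v y) (dot0l y)). Qed.

Lemma dot_ge0 x : 0 <= dot x x.
Proof. by apply: sumr_ge0 => j _; rewrite -expr2 sqr_ge0. Qed.

Lemma enorm_ge0 x : 0 <= enorm x.
Proof. exact: sqrtr_ge0. Qed.

Lemma enorm_sqr x : enorm x ^+ 2 = dot x x.
Proof. by rewrite sqr_sqrtr ?dot_ge0. Qed.

Lemma dot_eq0 x : dot x x = 0 -> x = 0.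
Proof.
move/eqP; rewrite psumr_eq0 => [/allP x0|j _]; last by rewrite -expr2 sqr_ge0.
apply/rowP => j; rewrite mxE.
by have := x0 j (mem_index_enum j); rewrite mulf_eq0 orbb => /eqP.
Qed.

Lemma enorm0 : enorm (0 : 'rV[R]_n) = 0.
Proof. by rewrite /enorm dot0l sqrtr0. Qed.

Lemma enormZ a x : enorm (a *: x) = `|a| * enorm x.
Proof.
by rewrite /enorm dotZl dotZr mulrA -expr2 sqrtrM ?sqr_ge0// sqrtr_sqr.
Qed.

Lemma enormB x y : enorm (x - y) = enorm (y - x).
Proof. by rewrite -opprB -scaleN1r enormZ normrN1 mul1r. Qed.

(** Cauchy-Schwarz: the squared norm of <y,y> x - <x,y> y is <y,y> (<x,x> <y,y> - <x,y>^2), and it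
    is nonnegative. *)
Lemma dot_le x y : dot x y <= enorm x * enorm y.
Proof.
have [y0|y0] := eqVneq (dot y y) 0.
  by rewrite (dot_eq0 _ y0) dotC dot0l enorm0 mulr0.
have yy : 0 < dot y y by rewrite lt_neqAle eq_sym y0 dot_ge0.
have [xy|xy] := leP (dot x y) 0.
  by rewrite (le_trans xy)// mulr_ge0// enorm_ge0.
rewrite -(@ler_pXn2r _ 2)// ?nnegrE ?(ltW xy) ?mulr_ge0 ?enorm_ge0//.
rewrite exprMn !enorm_sqr.
have := dot_ge0 (dot y y *: x - dot x y *: y).
rewrite !(dotDl, dotDr, dotNl, dotNr, dotZl, dotZr) (dotC y x) => h.
rewrite -(ler_pM2l yy); lra.
Qed.

Lemma ler_enormD x y : enorm (x + y) <= enorm x + enorm y.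
Proof.
rewrite -(@ler_pXn2r _ 2)// ?nnegrE ?addr_ge0 ?enorm_ge0//.
rewrite sqrrD !enorm_sqr !(dotDl, dotDr) (dotC y x).
have := dot_le x y; lra.
Qed.

Lemma ler_enormB x y : enorm (x - y) <= enorm x + enorm y.
Proof. by rewrite (le_trans (ler_enormD _ _))// -(sub0r y) enormB subr0. Qed.

Lemma ler_enorm_sum (I : finType) (F : I -> 'rV[R]_n) :
  enorm (\sum_i F i) <= \sum_i enorm (F i).
Proof.
elim/big_ind2: _ => [|x a y b xa yb|//]; first by rewrite enorm0.
by rewrite (le_trans (ler_enormD _ _))// lerD.
Qed.

Lemma ler_coord_enorm x j : `|x 0 j| <= enorm x.
Proof.
rewrite -(@ler_pXn2r _ 2)// ?nnegrE ?enorm_ge0// enorm_sqr real_normK ?num_real//.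
rewrite /dot (bigD1 j)//= -expr2 lerDl.
by apply: sumr_ge0 => i _; rewrite -expr2 sqr_ge0.
Qed.

End Euclidean.

(** * Directional derivatives and strong convexity *)

Section Calculus.
Context {R : realType} {n : nat}.
Implicit Types (f : 'rV[R]_n -> R) (x y d : 'rV[R]_n).

Lemma cvg_directional f x d : differentiable (f : _ -> R^o) x ->
  h^-1 * (f (x + h *: d) - f x) @[h --> 0^'+] --> dot (grad f x) d.
Proof.
move=> df; apply: cvg_dnbhs_at_right.
have <- : 'D_d (f : _ -> R^o) x = dot (grad f x) d.
  rewrite deriveE// {1}(row_sum_delta d) linear_sum /dot.
  by apply: eq_bigr => j _; rewrite linearZ/= mxE deriveE// mulrC.
have := @diff_derivable _ _ _ _ x d df.
rewrite /derivable -/('D_d (f : _ -> R^o) x) => fl.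
by under eq_fun do rewrite [x + _]addrC; exact: fl.
Qed.

Lemma strongly_convex_ge f s x y :
  differentiable (f : _ -> R^o) x -> strongly_convex f s ->
  f x + dot (grad f x) (y - x) + s / 2 * enorm (y - x) ^+ 2 <= f y.
Proof.
move=> df [s0 cf]; set d := y - x.
have yE : y = x + d by rewrite /d addrC subrK.
set c := s / 2 * enorm d ^+ 2.
(* Convexity of f - s/2 |.|^2 on the segment from x to y bounds this quotient by f y - f x - c for 0
   < h < 1; the term h c is what the quadratic part leaves, and it vanishes in the limit. *)
have qc : h^-1 * (f (x + h *: d) - f x) - h * c @[h --> 0^'+] -->
    dot (grad f x) d - 0 * c.
  apply: cvgB; first exact: cvg_directional.
  by apply: cvgM; [exact/cvg_at_right_filter/cvg_id|exact: cvg_cst].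
rewrite -subr_ge0 mul0r subr0 in qc *.
suff : dot (grad f x) d <= f y - f x - c by lra.
apply: (cvgr_to_le qc); near=> h.
have h0 : 0 < h by near: h; exact: nbhs_right_gt.
have h1 : h < 1 by near: h; exact: nbhs_right_lt.
have : f (x + h *: d) - s / 2 * enorm (x + h *: d) ^+ 2 <=
    h * (f y - s / 2 * enorm y ^+ 2) + (1 - h) * (f x - s / 2 * enorm x ^+ 2).
  have <- : h *: y + (1 - h) *: x = x + h *: d.
    by rewrite /d scalerBr scalerBl scale1r addrCA.
  exact: (cf (Itv01 (ltW h0) (ltW h1)) y x (in_setT _) (in_setT _)).
rewrite /c !enorm_sqr yE; clearbody d.
rewrite !(dotDl, dotDr, dotZl, dotZr) (dotC d x) => cx.
rewrite -(ler_pM2l h0) mulrBr mulrA mulfV ?gt_eqF// mul1r; lra.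
Unshelve. all: by end_near. Qed.

(** Sum of the first-order inequalities at x and at y, each giving half of the modulus. *)
Lemma strongly_convex_monotone f s x y :
  (forall z, differentiable (f : _ -> R^o) z) -> strongly_convex f s ->
  s * enorm (x - y) ^+ 2 <= dot (grad f x - grad f y) (x - y).
Proof.
move=> df cf; have := strongly_convex_ge f s x y (df x) cf.
have := strongly_convex_ge f s y x (df y) cf.
rewrite (enormB y x) -(opprB x y) dotNr dotDl dotNl; lra.
Qed.

End Calculus.

(** * First-order optimality *)

Section Minimizer.
Context {R : realType} {N n : nat}.

(** At a minimizer every one-sided directional derivative is nonnegative; the direction opposite to
    the gradient sum g gives - |g|^2 >= 0. *)
Lemma sum_grad_minimizer (f : 'I_N -> 'rV[R]_n -> R) (x : 'rV[R]_n) :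
  (0 < N)%N -> (forall i z, differentiable (f i : _ -> R^o) z) ->
  (forall y, average_cost f x <= average_cost f y) ->
  \sum_i grad (f i) x = 0.
Proof.
move=> N0 df fmin.
have ge0 d : 0 <= dot (\sum_i grad (f i) x) d.
  have : \sum_i h^-1 * (f i (x + h *: d) - f i x) @[h --> 0^'+] -->
      \sum_i dot (grad (f i) x) d.
    by apply: cvg_big => [|i _]; [exact: add_continuous|exact: cvg_directional].
  rewrite dot_suml => /cvgr_to_ge; apply; near=> h.
  have h0 : 0 < h by near: h; exact: nbhs_right_gt.
  rewrite -mulr_sumr sumrB pmulr_rge0 ?invr_gt0// subr_ge0.
  by have := fmin (x + h *: d); rewrite /average_cost ler_pM2l// invr_gt0 ltr0n.
set g := \sum_i _ in ge0 *; apply: dot_eq0; apply/le_anti.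
by rewrite dot_ge0 andbT; have := ge0 (- g); rewrite dotNr oppr_ge0.
Unshelve. all: by end_near. Qed.

End Minimizer.

(** * Powers of a primitive stochastic matrix and consensus *)

Section Consensus.
Context {R : realType} {N : nat}.
Implicit Types (E : rel 'I_N) (A : 'M[R]_N).

(** [eig_est A k i] is row i of the power A^k, so this is A^(k+1) = A A^k entrywise. *)
Lemma eig_estS A k i j :
  eig_est A k.+1 i 0 j = \sum_l A i l * eig_est A k l 0 j.
Proof. by rewrite /= summxE; apply: eq_bigr => l _; rewrite mxE. Qed.

Lemma weighted_adjacency_ge0 {E A} : weighted_adjacency E A ->
  forall i j, 0 <= A i j.
Proof.
move=> hA i j; have [pos null] := hA i j.
by case: (boolP (E j i)) => [/pos/ltW//|/null ->].
Qed.

Lemma eig_est_ge0 {A} : (forall i j, 0 <= A i j) ->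
  forall k i j, 0 <= eig_est A k i 0 j.
Proof.
move=> A0; elim=> [|k IH] i j; first by rewrite mxE.
by rewrite eig_estS sumr_ge0// => l _; rewrite mulr_ge0.
Qed.

Lemma eig_est_sum1 {A} : row_stochastic A ->
  forall k i, \sum_j eig_est A k i 0 j = 1.
Proof.
move=> A1; elim=> [|k IH] i.
  rewrite (bigD1 i)//= big1 => [|j ji]; first by rewrite mxE !eqxx addr0.
  by rewrite mxE (negbTE ji) andbF.
under eq_bigr do rewrite eig_estS.
rewrite exchange_big /= -(A1 i); apply: eq_bigr => l _.
by rewrite -mulr_sumr IH mulr1.
Qed.

Lemma eig_est_connect E A i j : weighted_adjacency E A -> connect E j i ->
  exists m, 0 < eig_est A m i 0 j.
Proof.
move=> hA /connectP[p + ->]; elim/last_ind: p => [|p b IH].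
  by exists 0; rewrite mxE !eqxx.
rewrite rcons_path last_rcons => /andP[/IH[m m0] /(proj1 (hA _ _)) Ab].
have A0 := weighted_adjacency_ge0 hA.
exists m.+1; rewrite eig_estS (bigD1 (last j p))//= ltr_pwDl ?mulr_gt0//.
by apply: sumr_ge0 => l _; rewrite mulr_ge0 ?eig_est_ge0.
Qed.

(* The positive diagonal makes a strongly connected [A] primitive. *)
Lemma eig_est_lower_bound {E A} : weighted_adjacency E A -> row_stochastic A ->
  strongly_connected E -> (forall i, 0 < A i i) ->
  exists M (b : R), [/\ 0 < b, b <= 1 &
    forall k i j, (M <= k)%N -> b <= eig_est A k i 0 j].
Proof.
move=> hA A1 hE Aii; have A0 := weighted_adjacency_ge0 hA.
have P0 := eig_est_ge0 A0.
(* The positive diagonal keeps a positive entry positive in all later powers, so the largest of the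
   finitely many exponents serves all pairs at once. *)
have pos_mono i j m k : (m <= k)%N ->
    0 < eig_est A m i 0 j -> 0 < eig_est A k i 0 j.
  move=> /subnK <-; elim: (k - m)%N => // r IH /IH pr.
  rewrite addSn eig_estS (bigD1 i)//= ltr_pwDl ?mulr_gt0//.
  by apply: sumr_ge0 => l _; rewrite mulr_ge0.
have /fin_all_exists[M M0] (ij : 'I_N * 'I_N) :
    exists m, 0 < eig_est A m ij.1 0 ij.2 by exact: eig_est_connect.
pose K := (\max_ij M ij)%N.
pose b := \big[Order.min/1]_(ij : 'I_N * 'I_N) eig_est A K ij.1 0 ij.2.
have bP i j : b <= eig_est A K i 0 j.
  exact: (bigmin_le 1 (i, j) (fun ij => eig_est A K ij.1 0 ij.2)).
exists K, b; split; [|exact: bigmin_le_id|].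
  apply: lt_bigmin => //= ij _; apply: pos_mono (M0 ij).
  exact: (leq_bigmax ij).
(* Rows of a later power are convex combinations of rows of the previous one, so the lower bound b
   persists. *)
move=> k i j /subnK <-; elim: (k - K)%N i => [|r IH] i; first exact: bP.
rewrite addSn eig_estS -[b]mul1r -(A1 i) mulr_suml.
by apply: ler_sum => l _; rewrite ler_wpM2l.
Qed.

(** Rows of A sum to 1, so a shift common to all nodes passes through averaging unchanged. The
    accumulated shift d does not depend on i and cancels in differences between nodes. *)
Lemma consensus_steps {A m} {x : nat -> 'I_N -> 'rV[R]_m} {c : nat -> 'rV[R]_m} :
  row_stochastic A ->
  (forall k i, x k.+1 i = \sum_j A i j *: x k j - c k) ->
  forall k r, exists d, forall i,
    x (k + r)%N i = \sum_j eig_est A r i 0 j *: x k j - d.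
Proof.
move=> A1 xS k; elim=> [|r [d xr]].
  exists 0 => i; rewrite addn0 subr0 (bigD1 i)//= big1 => [|j ji].
    by rewrite mxE !eqxx scale1r addr0.
  by rewrite mxE (negbTE ji) andbF scale0r.
exists (d + c (k + r)%N) => i; rewrite addnS xS opprD addrA; congr (_ - _).
under eq_bigr do rewrite xr scalerBr.
rewrite sumrB -scaler_suml A1 scale1r; congr (_ - _).
under [RHS]eq_bigr do rewrite eig_estS scaler_suml.
rewrite exchange_big; apply: eq_bigr => j _ /=; rewrite scaler_sumr.
by apply: eq_bigr => l _; rewrite scalerA.
Qed.

(** The difference of two averages is the average of v_j - v_l with weights P_ij P_kl. For each j
    the term l = j vanishes and carries weight P_kj >= b, which leaves weight at most 1 - b. *)
Lemma averaging_contraction m (P : 'I_N -> 'I_N -> R) (b d : R)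
    (v : 'I_N -> 'rV[R]_m) :
  (forall i j, 0 <= P i j) -> (forall i, \sum_j P i j = 1) ->
  (forall i j, b <= P i j) -> (forall i j, enorm (v i - v j) <= d) ->
  forall i k,
    enorm (\sum_j P i j *: v j - \sum_j P k j *: v j) <= (1 - b) * d.
Proof.
move=> P0 P1 Pb vd i k.
have d0 : 0 <= d by rewrite (le_trans (enorm_ge0 _) (vd i i)).
have -> : \sum_j P i j *: v j - \sum_j P k j *: v j =
    \sum_j P i j *: \sum_l P k l *: (v j - v l).
  transitivity (\sum_j P i j *: (v j - \sum_l P k l *: v l)).
    under [RHS]eq_bigr do rewrite scalerBr.
    by rewrite sumrB -scaler_suml P1 scale1r.
  apply: eq_bigr => j _; under [in RHS]eq_bigr do rewrite scalerBr.
  by rewrite sumrB -scaler_suml P1 scale1r.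
rewrite (le_trans (ler_enorm_sum _ _))// -[leRHS]mul1r -{1}(P1 i) mulr_suml.
apply: ler_sum => j _; rewrite enormZ ger0_norm// ler_wpM2l//.
rewrite (le_trans (ler_enorm_sum _ _))// (bigD1 j)//= subrr scaler0 enorm0 add0r.
rewrite (@le_trans _ _ (\sum_(l | l != j) P k l * d))//.
  by apply: ler_sum => l _; rewrite enormZ ger0_norm// ler_wpM2l.
rewrite -mulr_suml ler_wpM2r//.
have /eqP := P1 k; rewrite (bigD1 j)//= eq_sym addrC -subr_eq => /eqP <-.
by rewrite lerD2l lerN2.
Qed.

(** Each block of M steps shrinks the diameter of the states by the factor 1 - b, and the steps
    within a block never increase it. *)
Lemma consensus {E A m} {x : nat -> 'I_N -> 'rV[R]_m} {c : nat -> 'rV[R]_m} :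
  weighted_adjacency E A -> row_stochastic A ->
  strongly_connected E -> (forall i, 0 < A i i) ->
  (forall k i, x k.+1 i = \sum_j A i j *: x k j - c k) ->
  forall eps, 0 < eps ->
    exists K, forall k, (K <= k)%N -> forall i j, enorm (x k i - x k j) < eps.
Proof.
move=> hA A1 hE Aii xS eps eps0.
have P0 := eig_est_ge0 (weighted_adjacency_ge0 hA).
have [M [b [b0 b1 bP]]] := eig_est_lower_bound hA A1 hE Aii.
have shrink (a d : R) k r : (forall i j, a <= eig_est A r i 0 j) ->
    (forall i j, enorm (x k i - x k j) <= d) ->
    forall i j, enorm (x (k + r)%N i - x (k + r)%N j) <= (1 - a) * d.
  move=> aP xd i j; have [e xr] := consensus_steps A1 xS k r.
  rewrite !xr opprB addrA subrK.
  exact: averaging_contraction (P0 r) (eig_est_sum1 A1 r) aP xd i j.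
pose d0 := \sum_i \sum_j enorm (x 0 i - x 0 j).
have xd0 i j : enorm (x 0 i - x 0 j) <= d0.
  rewrite /d0 (bigD1 i)//= (bigD1 j)//= -addrA lerDl addr_ge0// sumr_ge0// => *.
    exact: enorm_ge0.
  by apply: sumr_ge0 => *; exact: enorm_ge0.
have xM s i j : enorm (x (s * M)%N i - x (s * M)%N j) <= (1 - b) ^+ s * d0.
  elim: s i j => [|s IH] i j; first by rewrite mul0n expr0 mul1r.
  by rewrite mulSnr exprS -mulrA; apply: shrink => // i' j'; exact: bP.
have : geometric d0 (1 - b) @ \oo --> 0.
  by apply: cvg_geometric; rewrite ger0_norm; lra.
move=> /cvgrPdist_lt/(_ _ eps0)[s _ /(_ s (leqnn s))] /=.
rewrite sub0r normrN => ds; exists (s * M)%N => k /subnKC <- i j.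
(* For the steps after the last full block the entry bound 0 suffices: it gives the factor 1. *)
have := shrink 0 _ (s * M)%N (k - s * M)%N (fun i j => P0 _ i j) (xM s) i j.
rewrite subr0 mul1r => /le_lt_trans; apply; rewrite mulrC.
exact: le_lt_trans (ler_norm _) ds.
Qed.

(** Since u A^k = u and the entries of u sum to 1, u minus row i of A^k is the combination of the
    differences (row l) - (row i) with coefficients u_l. The rows evolve by A without input, so
    consensus applies to them. *)
Lemma eig_est_cvg {E A u} : weighted_adjacency E A -> row_stochastic A ->
  strongly_connected E -> (forall i, 0 < A i i) ->
  normalized_left_eigenvector A u ->
  forall eps, 0 < eps -> exists K, forall k, (K <= k)%N ->
    forall i j, `|u 0 j - eig_est A k i 0 j| < eps.
Proof.
move=> hA A1 hE Aii [uA u1] eps eps0.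
have uP k j : \sum_i u 0 i * eig_est A k i 0 j = u 0 j.
  elim: k => [|k IH].
    rewrite (bigD1 j)//= big1 => [|i ij]; first by rewrite mxE !eqxx mulr1 addr0.
    by rewrite mxE eq_sym (negbTE ij) andbF mulr0.
  under eq_bigr do rewrite eig_estS mulr_sumr.
  rewrite exchange_big -IH; apply: eq_bigr => l _ /=.
  rewrite -{2}uA mxE mulr_suml.
  by apply: eq_bigr => i _; rewrite mulrA.
pose U := 1 + \sum_i `|u 0 i|.
have U0 : 0 < U by rewrite ltr_pwDl// sumr_ge0.
have [|K hK] := @consensus E A N (eig_est A) (fun=> 0) hA A1 hE Aii _
  (eps / U) (divr_gt0 eps0 U0); first by move=> k i; rewrite subr0.
exists K => k /hK {}hK i j.
have -> : u 0 j - eig_est A k i 0 j =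
    \sum_l u 0 l * (eig_est A k l - eig_est A k i) 0 j.
  under eq_bigr do rewrite !mxE mulrBr.
  by rewrite sumrB uP -mulr_suml u1 mul1r.
rewrite (le_lt_trans (ler_norm_sum _ _ _))//.
apply: (@le_lt_trans _ _ (\sum_l `|u 0 l| * (eps / U))).
  apply: ler_sum => l _; rewrite normrM ler_wpM2l//.
  exact: le_trans (ler_coord_enorm _ _) (ltW (hK l i)).
by rewrite -mulr_suml mulrCA gtr_pMr// ltr_pdivrMr// mul1r /U ltrDr.
Qed.

End Consensus.

(** * Tracker equilibria and the telescoped direction *)

Section Tracking.
Context {R : realType} {N : nat}.
Context {A : 'M[R]_N} {kappa : R} {tau : nat -> nat} {T : nat}.

(** The delayed index t - tau t never exceeds t, so strong induction on time determines the
    trajectory. *)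
Lemma response_unique {m l} {W : 'M[R]_(N, m)} {y z : nat -> 'M[R]_(N, m)} :
  response A kappa tau T l W y -> response A kappa tau T l W z -> y = z.
Proof.
move=> [y0 yS] [z0 zS]; apply/funext => t.
elim/ltn_ind: t => -[_|t IH]; first by rewrite y0 z0.
apply/row_matrixP => i.
have := yS t i; rewrite (IH t)// => /eqP; rewrite subr_eq => /eqP ->.
have := zS t i => /eqP; rewrite subr_eq => /eqP ->.
congr (_ - _ *: _ + _); apply: eq_bigr => j _.
by rewrite (IH (t - tau t)%N)// ltnS leq_subr.
Qed.

Lemma equilibrium_unique {m l} {W : 'M[R]_(N, m)} {c d} : (0 < N)%N ->
  equilibrium_due_to A kappa tau T l W c ->
  equilibrium_due_to A kappa tau T l W d -> c = d.
Proof.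
move=> N0 [y ry yc] [z rz zd]; apply/rowP => j.
rewrite -(response_unique ry rz) in zd.
exact: cvg_unique (yc (Ordinal N0) j) (zd (Ordinal N0) j).
Qed.

(** The phases at the two midpoints are l pi + pi/2 and l pi - pi/2, whose sines are cos(l pi) and
    its opposite; the jump is therefore the sign of cos(l pi), which is nonzero. *)
Lemma normr_wave_jump l : (0 < T)%N -> `|wave_jump T l| = 1 :> R.
Proof.
move=> T0; rewrite /wave_jump /square_wave.
have TR : (T%:R : R) != 0 by rewrite pnatr_eq0 -lt0n.
have -> : 2 * pi * ((l%:R + 2^-1) * T%:R) / (2 * T%:R) = l%:R * pi + pi / 2 :> R.
  by field.
have -> : 2 * pi * ((l%:R - 2^-1) * T%:R) / (2 * T%:R) = l%:R * pi - pi / 2 :> R.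
  by field.
rewrite sinDpihalf sinBpihalf sgrN.
suff c0 : cos (l%:R * pi) != 0 :> R.
  rewrite (_ : _ - _ = Num.sg (cos (l%:R * pi))) ?normr_sg ?c0//; lra.
elim: l => [|l IH]; first by rewrite mul0r cos0 oner_eq0.
by rewrite -natr1 mulrDl mul1r cosDpi oppr_eq0.
Qed.

End Tracking.

(** Applied to the delays, this makes the tracking factor 1 + kappa taubar positive. *)
Lemma cvg_arithmetic_mean_ge0 (R : realType) (v : nat -> R) (a : R) :
  (forall k, 0 <= v k) -> arithmetic_mean v @ \oo --> a -> 0 <= a.
Proof.
move=> v0 /cvgr_to_ge; apply; apply: nearW => k.
by rewrite mulr_ge0// sumr_ge0.
Qed.

(** By uniqueness of equilibria, [cr l] and [cs l - cs l.-1] both carry the factor 1/(1 + kappa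
    taubar). It cancels in their quotient, because the wave jump has modulus 1 and u sums to 1, and
    the sum then telescopes. *)
Lemma run_directionE {R : realType} {N n : nat} {f : 'I_N -> 'rV[R]_n -> R}
    {A : 'M[R]_N} {u : 'rV[R]_N} {kappa taubar : R} {tau : nat -> nat}
    {T : nat} {alpha : nat -> R} {x p : nat -> 'I_N -> 'rV[R]_n}
    {cr : nat -> 'rV[R]_n} {cs : nat -> R} :
  (0 < N)%N -> (0 < T)%N -> \sum_i u 0 i = 1 -> 0 < 1 + kappa * taubar ->
  tracking_result A kappa tau T u taubar ->
  delay_robust_run f A u kappa tau T alpha x p cr cs ->
  forall k i, p k.+1 i = ubar u (scaled_grads f A x k).
Proof.
move=> N0 T0 u1 pos htrack [hcr hcs hp _] k i.
rewrite hp.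
have crE l : (0 < l)%N -> `|cs l - cs l.-1|^-1 *: cr l =
    ubar u (scaled_grads f A x l) - ubar u (scaled_grads f A x l.-1).
  move=> l0.
  have := equilibrium_unique N0 (hcs l l0) (htrack _ _ _ l0).
  move/matrixP/(_ 0 0); rewrite !mxE eqxx mulr1n => ->.
  under eq_bigr do rewrite mxE.
  rewrite -mulr_suml u1 mul1r normrM normr_wave_jump// mulr1.
  rewrite (equilibrium_unique N0 (hcr l l0) (htrack _ _ _ l0)).
  rewrite normfV invrK gtr0_norm// scalerA mulfV ?gt_eqF// scale1r.
  by rewrite /ubar mulmxBr.
rewrite big_nat_cond; under eq_bigr => l /andP[/andP[l0 _] _] do rewrite crE//.
rewrite -big_nat_cond big_add1 /=.
by rewrite telescope_sumr// subrK.
Qed.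

(** * Gradient descent with vanishing relative errors *)

Lemma perturbed_contraction (R : realType) (q : R) (e : nat -> R) :
  0 <= q -> q < 1 -> (forall k, 0 <= e k) ->
  (forall eta, 0 < eta -> exists K, forall k, (K <= k)%N ->
    e k.+1 <= q * e k + eta * (1 + e k)) ->
  forall eps, 0 < eps -> exists K, forall k, (K <= k)%N -> e k < eps.
Proof.
move=> q0 q1 e0 eS eps eps0; pose d := Num.min 1 (eps / 2).
have d0 : 0 < d by rewrite lt_min ltr01 divr_gt0.
have d1 : d <= 1 by rewrite ge_min lexx.
have deps : d <= eps / 2 by rewrite ge_min lexx orbT.
pose r := (1 + q) / 2.
(* As q + (1 - r) = r and d <= 1, this choice of eta turns the recursion into e(k+1) <= r e(k) + (1
   - r) d, whose fixed point is d <= eps/2. *)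
have [|K eK] := eS ((1 - r) * d); first by rewrite mulr_gt0// /r; lra.
have er m : e (K + m)%N <= r ^+ m * e K + d.
  elim: m => [|m IH]; first by rewrite addn0 expr0 mul1r lerDl ltW.
  rewrite addnS (le_trans (eK _ (leq_addr _ _)))// exprS -mulrA.
  have : (1 - r) * d * e (K + m)%N <= (1 - r) * e (K + m)%N.
    by rewrite ler_wpM2r// ler_piMr// /r; lra.
  have : r * e (K + m)%N <= r * (r ^+ m * e K + d).
    by rewrite ler_wpM2l// /r; lra.
  by rewrite /r; lra.
have : geometric (e K) r @ \oo --> 0.
  by apply: cvg_geometric; rewrite ger0_norm /r; lra.
have eps2 : 0 < eps / 2 by lra.
move=> /cvgrPdist_lt/(_ _ eps2)[m _ hm]; exists (K + m)%N => k Kmk.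
have Kk : (K <= k)%N by rewrite (leq_trans _ Kmk)// leq_addr.
have /hm /= : (m <= k - K)%N by rewrite leq_subRL.
rewrite sub0r normrN mulrC => /(le_lt_trans (ler_norm _)) rk.
by have := er (k - K)%N; rewrite subnKC// => ek; lra.
Qed.

(** A step a multiplies the squared distance by at most 1 - 2 a mu + a^2 L^2; a = mu/L^2 minimizes
    this, with value 1 - (mu/L)^2. *)
Lemma gradient_step_contraction {R : realType} {n : nat}
    {g : 'rV[R]_n -> 'rV[R]_n} {mu L : R} {x y : 'rV[R]_n} :
  0 < mu -> mu <= L ->
  mu * enorm (x - y) ^+ 2 <= dot (g x - g y) (x - y) ->
  enorm (g x - g y) <= L * enorm (x - y) ->
  enorm (x - y - (mu / L ^+ 2) *: (g x - g y)) <=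
    Num.sqrt (1 - (mu / L) ^+ 2) * enorm (x - y).
Proof.
move=> mu0 muL mono lip; have L0 : 0 < L by lra.
set q := mu / L; set z := x - y in mono lip *; set h := g x - g y in mono lip *.
have q0 : 0 < q by rewrite divr_gt0.
have q1 : q <= 1 by rewrite ler_pdivrMr// mul1r.
have q2 : 0 <= 1 - q ^+ 2 by rewrite subr_ge0 expr_le1// ltW.
rewrite -(@ler_pXn2r _ 2)// ?nnegrE ?mulr_ge0 ?sqrtr_ge0 ?enorm_ge0//.
rewrite exprMn (sqr_sqrtr q2) enorm_sqr; clearbody z h.
rewrite !(dotDl, dotDr, dotNl, dotNr, dotZl, dotZr) (dotC z h) -!enorm_sqr.
have hz : (mu / L ^+ 2) ^+ 2 * enorm h ^+ 2 <= q ^+ 2 * enorm z ^+ 2.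
  have -> : q ^+ 2 = (mu / L ^+ 2) ^+ 2 * L ^+ 2.
    by rewrite /q; field; rewrite gt_eqF.
  rewrite -[leRHS]mulrA -(exprMn _ L) ler_wpM2l ?sqr_ge0// ler_pXn2r// nnegrE ?enorm_ge0//.
  by rewrite mulr_ge0 ?enorm_ge0// ltW.
have dz : q ^+ 2 * enorm z ^+ 2 <= mu / L ^+ 2 * dot h z.
  have -> : q ^+ 2 = mu / L ^+ 2 * mu by rewrite /q; field; rewrite gt_eqF.
  by rewrite -[leLHS]mulrA ler_wpM2l// divr_ge0 ?sqr_ge0// ltW.
lra.
Qed.

Section InexactGradient.
Context {R : realType} {N n : nat}.
Context {f : 'I_N -> 'rV[R]_n -> R} {L G : R} {xs : 'rV[R]_n}.
(** Each term splits into a weight error (w_j - 1) grad f_j(x_j) and a Lipschitz error of size d L.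
    The gradient in the former may grow linearly away from [xs], whence the factor 1 + |z - xs|. *)
Lemma inexact_gradient {x : 'I_N -> 'rV[R]_n} {w : 'I_N -> R}
    {z : 'rV[R]_n} {d : R} : 0 <= L ->
  (forall i x y,
    enorm (grad (f i) x - grad (f i) y) <= L * enorm (x - y)) ->
  (forall i, enorm (grad (f i) xs) <= G) ->
  d <= 1 -> (forall j, enorm (x j - z) <= d) -> (forall j, `|w j - 1| <= d) ->
  enorm (\sum_j w j *: grad (f j) (x j) - \sum_j grad (f j) z) <=
    d * (N%:R * (G + 2 * L)) * (1 + enorm (z - xs)).
Proof.
move=> L0 lip boundG d1 xd wd; rewrite -sumrB (le_trans (ler_enorm_sum _ _))//.
apply: (@le_trans _ _ (\sum_(j < N) d * (G + 2 * L) * (1 + enorm (z - xs)))).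
  apply: ler_sum => j _; set e := enorm (z - xs).
  have d0 : 0 <= d by rewrite (le_trans (enorm_ge0 _) (xd j)).
  have e0 : 0 <= e := enorm_ge0 _.
  have G0 : 0 <= G by rewrite (le_trans (enorm_ge0 _) (boundG j)).
  have -> : w j *: grad (f j) (x j) - grad (f j) z =
      (w j - 1) *: grad (f j) (x j) + (grad (f j) (x j) - grad (f j) z).
    by rewrite scalerBl scale1r addrA subrK.
  have gx : enorm (grad (f j) (x j)) <= G + L * (1 + e).
    rewrite -(subrK (grad (f j) xs) (grad _ _)) addrC.
    rewrite (le_trans (ler_enormD _ _))// lerD//.
    rewrite (le_trans (lip _ _ _))// ler_wpM2l// -(subrK z (x j)) -addrA.
    by rewrite (le_trans (ler_enormD _ _))// lerD2r (le_trans (xd j)).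
  rewrite (le_trans (ler_enormD _ _))// enormZ.
  have : `|w j - 1| * enorm (grad (f j) (x j)) <= d * (G + L * (1 + e)).
    by rewrite ler_pM// enorm_ge0.
  have : enorm (grad (f j) (x j) - grad (f j) z) <= d * L.
    by rewrite (le_trans (lip _ _ _))// mulrC ler_wpM2r.
  (* Exactly the gap between the sum of the two bounds and d (G + 2 L) (1 + e). *)
  have : 0 <= d * (G * e + L * e) by rewrite mulr_ge0// addr_ge0// mulr_ge0.
  lra.
by rewrite sumr_const card_ord -mulr_natl; lra.
Qed.

End InexactGradient.

(** * Convergence of the algorithm *)

Theorem theorem2 (R : realType) (N n : nat) (hN : (0 < N)%N) (hn : (0 < n)%N)
  (E : rel 'I_N) (A : 'M[R]_N) (u : 'rV[R]_N)
  (hA : weighted_adjacency E A) (hstoch : row_stochastic A)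
  (hu : normalized_left_eigenvector A u)
  (hest : forall (k : nat) (i : 'I_N), 0 < eig_est A k i 0 i)
  (kappa taubar : R) (tau : nat -> nat) (T : nat)
  (hkappa : 0 < kappa) (hT : (0 < T)%N)
  (hdelay : forall t : nat, (tau t <= T)%N)
  (hmean : arithmetic_mean (fun t => (tau t)%:R : R) @ \oo --> taubar)
  (htrack : tracking_result A kappa tau T u taubar)
  (f : 'I_N -> 'rV[R]_n -> R) (l sigma : 'I_N -> R)
  (h1 : strongly_connected E)
  (h2 : forall i, convex (f i) /\ bounded_subgradient (f i))
  (h3 : forall i, smooth (f i) (l i) /\ strongly_convex (f i) (sigma i))
  (h4 : 3 / 4 < (\sum_i l i) ^+ 2 / (N%:R * \sum_i l i ^+ 2))
  (xstar : 'rV[R]_n)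
  (hmin : forall y : 'rV[R]_n, average_cost f xstar <= average_cost f y) :
  exists alpha : nat -> R,
    (forall k, 0 < alpha k) /\
    forall (x p : nat -> 'I_N -> 'rV[R]_n) (cr : nat -> 'rV[R]_n) (cs : nat -> R),
      delay_robust_run f A u kappa tau T alpha x p cr cs ->
      exists C : R, 0 < C /\
        forall eps : R, 0 < eps -> forall i : 'I_N,
          exists k3 : nat, forall k : nat, (k3 <= k)%N ->
            enorm (x k i - xstar) < C * eps.
Proof.
have A0 := weighted_adjacency_ge0 hA.
have Aii i : 0 < A i i.
  have := hest 1%N i; rewrite eig_estS (bigD1 i)//= big1 => [|j ji].
    by rewrite mxE !eqxx mulr1 addr0.
  by rewrite mxE eq_sym (negbTE ji) andbF mulr0.
have [uA u1] := hu.
have kt : 0 < 1 + kappa * taubar.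
  rewrite ltr_pwDl// mulr_ge0 ?(ltW hkappa)//.
  by apply: cvg_arithmetic_mean_ge0 hmean => t; exact: ler0n.
have df i z : differentiable (f i : _ -> R^o) z by case: (h3 i) => -[].
(* Adding mu secures mu <= L; the absolute values make L a Lipschitz constant both for each gradient
   and for their sum. *)
pose mu := \sum_i sigma i; pose L := mu + \sum_i `|l i|.
have mu0 : 0 < mu.
  rewrite /mu (bigD1 (Ordinal hN))//= ltr_pwDl//.
    by case: (h3 (Ordinal hN)) => _ [].
  by apply: sumr_ge0 => i _; apply: ltW; case: (h3 i) => _ [].
have muL : mu <= L by rewrite lerDl sumr_ge0.
have lip i x y : enorm (grad (f i) x - grad (f i) y) <= L * enorm (x - y).
  case: (h3 i) => -[_ /(_ x y) /le_trans lf] _; apply: lf.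
  rewrite ler_wpM2r ?enorm_ge0// (le_trans (ler_norm _))//.
  rewrite /L (bigD1 i)//= addrCA lerDl.
  by apply: addr_ge0; [exact: ltW|exact: sumr_ge0].
pose g z := \sum_i grad (f i) z.
have g_lip x y : enorm (g x - g y) <= L * enorm (x - y).
  rewrite /g -sumrB (le_trans (ler_enorm_sum _ _))//.
  apply: (@le_trans _ _ ((\sum_i `|l i|) * enorm (x - y))).
    rewrite mulr_suml; apply: ler_sum => i _.
    case: (h3 i) => -[_ /(_ x y) /le_trans lf] _; apply: lf.
    by rewrite ler_wpM2r ?enorm_ge0// ler_norm.
  by rewrite ler_wpM2r ?enorm_ge0// lerDr ltW.
have g_mono x y : mu * enorm (x - y) ^+ 2 <= dot (g x - g y) (x - y).
  rewrite /g -sumrB dot_suml mulr_suml; apply: ler_sum => i _.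
  by apply: strongly_convex_monotone => //; case: (h3 i).
have g0 : g xstar = 0 by exact: sum_grad_minimizer.
pose a := mu / L ^+ 2; pose q := Num.sqrt (1 - (mu / L) ^+ 2).
have L0 : 0 < L by rewrite (lt_le_trans mu0).
have a0 : 0 < a by rewrite divr_gt0// exprn_gt0.
have q1 : q < 1.
  by rewrite -sqrtr1 ltr_sqrt// gtrBl exprn_gt0// divr_gt0.
have [M [b [b0 b1 bP]]] := eig_est_lower_bound hA hstoch h1 Aii.
(* A constant step already converges, so [C = 1] works: the direction [p k.+1]
   is common to all nodes, hence does not disturb consensus. *)
exists (fun=> a); split=> // x p cr cs run.
exists 1; split=> // eps eps0 i; rewrite mul1r.
pose w k j := u 0 j / eig_est A k j 0 j.
have xS k j : x k.+1 j = \sum_m A j m *: x k m -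
    a *: \sum_m w k m *: grad (f m) (x k m).
  rewrite (run_descent run).
  rewrite (run_directionE hN hT u1 kt htrack run).
  rewrite /ubar mulmx_sum_row; congr (_ - _ *: _); apply: eq_bigr => m _.
  by rewrite rowK scalerA.
pose G := \sum_i enorm (grad (f i) xstar).
have boundG j : enorm (grad (f j) xstar) <= G.
  by rewrite /G (bigD1 j)//= lerDl sumr_ge0// => m _; exact: enorm_ge0.
have G0 : 0 <= G by rewrite (le_trans (enorm_ge0 _) (boundG i)).
pose c := N%:R * (G + 2 * L).
have c0 : 0 <= c by rewrite mulr_ge0// addr_ge0// mulr_ge0// ltW.
have ac0 : 0 <= a * c by rewrite mulr_ge0// ltW.
apply: (@perturbed_contraction _ q (fun k => enorm (x k i - xstar))) eps0 => //.
- exact: sqrtr_ge0.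
- by move=> k; exact: enorm_ge0.
(* In 1 + a c, the 1 accounts for the mixing error d and a c for the gradient error scaled by the
   step; d <= 1 is required by [inexact_gradient]. *)
move=> eta eta0; pose d := Num.min 1 (eta / (1 + a * c)).
have d0 : 0 < d by rewrite lt_min ltr01 divr_gt0// ltr_pwDl.
have d1 : d <= 1 by rewrite ge_min lexx.
have deta : d * (1 + a * c) <= eta.
  by rewrite -ler_pdivlMr ?ltr_pwDl// ge_min lexx orbT.
have [K1 hK1] := consensus hA hstoch h1 Aii xS d d0.
(* The tolerance d b becomes d after division by [e_j(k)]_j >= b. *)
have [K2 hK2] := eig_est_cvg hA hstoch h1 Aii hu (d * b) (mulr_gt0 d0 b0).
exists (maxn M (maxn K1 K2)) => k; rewrite !geq_max => /and3P[Mk /hK1 xd /hK2 ud].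
have wd j : `|w k j - 1| <= d.
  have Pj := hest k j; have bPj := bP k j j Mk.
  have -> : w k j - 1 = (u 0 j - eig_est A k j 0 j) / eig_est A k j 0 j.
    by rewrite mulrBl divff ?gt_eqF.
  rewrite normrM normfV (gtr0_norm Pj) ler_pdivrMr// (le_trans (ltW (ud j j)))//.
  by rewrite ler_wpM2l// ltW.
have xdi j : enorm (x k j - x k i) <= d by rewrite ltW.
have err := inexact_gradient (ltW L0) lip boundG d1 xdi wd.
have step := gradient_step_contraction mu0 muL (g_mono (x k i) xstar)
  (g_lip (x k i) xstar).
have mix : enorm (\sum_m A i m *: x k m - x k i) <= d.
  rewrite -[x k i]scale1r -(hstoch i) scaler_suml -sumrB.
  rewrite (le_trans (ler_enorm_sum _ _))// -[leRHS]mul1r -(hstoch i) mulr_suml.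
  by apply: ler_sum => m _; rewrite -scalerBr enormZ ger0_norm// ler_wpM2l.
set e := enorm (x k i - xstar) in step err *.
have e0 : 0 <= e := enorm_ge0 _.
rewrite xS; set v := \sum_m w k m *: _ in err *.
(* Exact descent step from x_i(k), plus the mixing error, minus a times the gradient error;
   [g xstar], which is 0, is inserted to match the contraction estimate. *)
have -> : \sum_m A i m *: x k m - a *: v - xstar =
    (x k i - xstar - a *: (g (x k i) - g xstar)) +
    ((\sum_m A i m *: x k m - x k i) - a *: (v - g (x k i))).
  by rewrite g0; apply/rowP => j; rewrite !mxE; ring.
rewrite (le_trans (ler_enormD _ _))// lerD//.
rewrite (le_trans (ler_enormB _ _))// enormZ (gtr0_norm a0).
apply: (@le_trans _ _ (d * (1 + a * c) * (1 + e))); last first.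
  by rewrite ler_wpM2r// addr_ge0.
have : a * enorm (v - g (x k i)) <= a * (d * c * (1 + e)).
  by rewrite ler_wpM2l// ltW.
have : 0 <= d * e by rewrite mulr_ge0// ltW.
lra.
Qed.
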